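(* Let $N\ge 2$ agents communicate over a fixed, undirected, connected graph; let $\mathcal N_i\neq\emptyset$ be the neighbor set of agent $i$. Fix weights $w_1,w_2,w_3>0$, a sampling period $h>0$, constants $d>0$, $\nu>0$, arbitrary initial values $\delta^0_{i,1},\dot\delta^0_{i,1}\in\mathbb R$, and real numbers $\alpha_i^k$ ($i=1,\dots,N$, $k\ge1$) satisfying \[ |\alpha_i^k|\le d\,e^{-\nu k h}\qquad\text{for all } i \text{ and all } k\ge 1 . \] Let the sequences $\delta^k_{i,0},\dot\delta^k_{i,0},u^k_{i,0},\delta^k_{i,1},\dot\delta^k_{i,1}$ ($k\ge1$) be generated by the unconstrained one-step distributed MPC scheme described in the context. Then, for all sufficiently small $h>0$, there exist $r_h\in(0,1)$, $M_0^h>0$ and $\dot M_0^h>0$ such that for all $k\ge1$ and all $i,j\in\{1,\dots,N\}$, \[ |\delta_{i,0}^k-\delta_{j,0}^k|\le M_0^h\, r_h^k,\qquad |\dot\delta_{i,0}^k|\le \dot M_0^h\, r_h^k . \] In particular $\delta_{i,0}^k-\delta_{j,0}^k\to0$ and $\dot\delta_{i,0}^k\to0$ as $k\to\infty$.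
   Context: Unconstrained distributed MPC scheme with prediction horizon $K=1$ (virtual-time deviation coordination). For $k=1,2,\dots$ and each agent $i$, define recursively \[ \delta^k_{i,0}=\delta^{k-1}_{i,1}-\alpha_i^k,\qquad \dot\delta^k_{i,0}=\dot\delta^{k-1}_{i,1}, \] let $u^k_{i,0}$ be the unique minimizer over $u\in\mathbb R$ of \[ \frac{w_1}{|\mathcal N_i|}\sum_{j\in\mathcal N_i}\Big(\delta^k_{i,0}+h\dot\delta^k_{i,0}+\tfrac{h^2}{2}u-\delta^{k-1}_{j,1}\Big)^2+w_2\big(\dot\delta^k_{i,0}+hu\big)^2+w_3u^2, \] and set \[ \delta^k_{i,1}=\delta^k_{i,0}+h\dot\delta^k_{i,0}+\tfrac{h^2}{2}u^k_{i,0},\qquad \dot\delta^k_{i,1}=\dot\delta^k_{i,0}+h\,u^k_{i,0}. \] Equivalently, $u^k_{i,0}=-a^h\frac{1}{|\mathcal N_i|}\sum_{j\in\mathcal N_i}(\delta^{k-1}_{i,1}-\delta^{k-1}_{j,1})-b^h\dot\delta^{k-1}_{i,1}+a^h\alpha_i^k$, where \[ a^h=\frac{w_1h^2}{2\left(w_3+w_2h^2+w_1\frac{h^4}{4}\right)},\qquad b^h=\frac{w_2h+w_1\frac{h^3}{2}}{w_3+w_2h^2+w_1\frac{h^4}{4}}. \] Here $\delta$ denotes the deviation of an agent's virtual time from real time, $\dot\delta$ the deviation of its rate from $1$, and $\alpha_i^k$ a path-following correction term. *)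

(* Defs.v *)
From mathcomp Require Import all_boot all_order all_algebra.
From mathcomp Require Import all_classical all_reals all_analysis.
Set Implicit Arguments. Unset Strict Implicit. Unset Printing Implicit Defensive.
Import Order.TTheory GRing.Theory Num.Theory.
Local Open Scope ring_scope.

(* Cost minimized by agent i at iteration k of the K = 1 distributed MPC
   scheme:  adj is the (symmetric) neighbor relation, so N_i = [pred j | adj i j];
   del0 / deld0 are delta^k_{i,0} and \dot delta^k_{i,0};
   prev j is delta^{k-1}_{j,1};  v is the candidate input u. *)
Definition mpc_cost (R : realType) (N : nat) (adj : rel 'I_N)
    (w1 w2 w3 h : R) (i : 'I_N) (del0 deld0 : R) (prev : 'I_N -> R) (v : R) : R :=
  w1 / (#|[pred j | adj i j]|)%:R *
    (\sum_(j | adj i j) (del0 + h * deld0 + h ^+ 2 / 2 * v - prev j) ^+ 2)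
  + w2 * (deld0 + h * v) ^+ 2 + w3 * v ^+ 2.

(* Main.v *)
Require Import Defs.
From mathcomp Require Import all_boot all_order all_algebra.
From mathcomp Require Import all_classical all_reals all_analysis.
From mathcomp Require Import ring lra.
Import Order.TTheory GRing.Theory Num.Theory.
Local Open Scope ring_scope.

(** Let [L = I - D^-1 A] be the normalized Laplacian, self-adjoint with
    [0 <= L <= 2] for the degree-weighted inner product. Eliminating the
    minimizer gives [u = - a L x - b v + a alpha], and without [alpha] one
    iteration is [x' = x + h m], [v' = 2 m - v], [m = v + h u / 2], where
    [kap v = m + (h a / 2) L x] and [kap = 1 - h b / 2]. The energy
    [a <x, L x> + kap |v|^2] then changes by exactly
    [a h^2 <m, L m> - 2 h b |m|^2 <= - 2 h (b - a h) |m|^2], and [a h < b].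
    Adding a small multiple [e] of [<x, L v> + b / (2 kap) <x, L x>], whose
    increment contains
    [- (h a / kap) |L x|^2] and no [<x, L m>] term, gives a strict Lyapunov
    function: on a connected graph [<x, L x> <= T |L x|^2], so it is
    dominated by [|m|^2 + |L x|^2] and hence contracts geometrically. The
    corrections [alpha] enter as an exponentially small perturbation. None of
    this restricts [h]. *)

(** * Sign automation and scalar lemmas *)

Ltac positivity := repeat first
  [ done | exact: ltW | exact: sqr_ge0 | exact: normr_ge0
  | match goal with
    | |- is_true (0 <= _ + _) => apply: addr_ge0
    | |- is_true (0 < _ + _) => apply: addr_gt0
    | |- is_true (0 <= _ * _) => apply: mulr_ge0
    | |- is_true (0 < _ * _) => apply: mulr_gt0
    | |- is_true (0 <= _ ^+ _) => apply: exprn_ge0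
    | |- is_true (0 < _ ^+ _) => apply: exprn_gt0
    | |- is_true (0 <= _^-1) => rewrite invr_ge0
    | |- is_true (0 < _^-1) => rewrite invr_gt0
    end ].

(** Comparison with the vertex [- B / (2 * A)], whose value is lower by
    [(2 * A * u + B) ^+ 2 / (4 * A)], forces that square to vanish. *)
Lemma quadratic_minimizer (R : realFieldType) (A B u : R) : 0 < A ->
  (forall v, A * u ^+ 2 + B * u <= A * v ^+ 2 + B * v) -> 2 * A * u = - B.
Proof.
move=> A0 umin; have := umin (- B / (2 * A)).
have -> : A * (- B / (2 * A)) ^+ 2 + B * (- B / (2 * A)) =
          A * u ^+ 2 + B * u - (2 * A * u + B) ^+ 2 / (4 * A).
  by field; rewrite gt_eqF.
move=> le_u; have : (2 * A * u + B) ^+ 2 / (4 * A) <= 0 by lra.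
rewrite pmulr_lle0 ?invr_gt0 ?mulr_gt0 // => sq_le0.
have : (2 * A * u + B) ^+ 2 == 0 by rewrite eq_le sq_le0 sqr_ge0.
by rewrite sqrf_eq0 => /eqP; lra.
Qed.

(** Any [t < 1] with [s <= t] and [rho < t] serves: [M] is so large that [K * t <= M * (t - rho)],
    which closes the induction. The clause [s <= t] lets the final rate also dominate the
    corrections themselves. *)
Lemma geometric_recurrence (R : realFieldType) (w : nat -> R) (K rho s : R) :
  0 < rho -> rho < 1 -> 0 < s -> s < 1 -> 0 <= K ->
  (forall k, w k.+1 <= rho * w k + K * s ^+ k.+1) ->
  exists t M, [/\ s <= t, t < 1, 0 < M & forall k, w k <= M * t ^+ k].
Proof.
move=> rho0 rho1 s0 s1 K0 wS.
have [t [st t1 rt]] : exists t, [/\ s <= t, t < 1 & rho < t].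
  exists ((1 + Num.max rho s) / 2).
  have m1 : Num.max rho s < 1 by rewrite gt_max rho1.
  have : rho <= Num.max rho s by rewrite le_max lexx.
  have : s <= Num.max rho s by rewrite le_max lexx orbT.
  by split; lra.
have t0 : 0 < t by lra.
have t_rho : 0 < t - rho by lra.
pose M : R := `|w 0%N| + 1 + K * t / (t - rho).
have Kt : 0 <= K * t / (t - rho) by positivity.
have M0 : 0 < M by rewrite /M; have := normr_ge0 (w 0%N); lra.
exists t, M; split => //.
elim=> [|k IHk].
  by rewrite expr0 mulr1 /M; have := ler_norm (w 0%N); lra.
apply: (le_trans (wS k)).
have sk : s ^+ k.+1 <= t ^+ k.+1 by rewrite lerXn2r ?nnegrE // ltW.
have le1 : rho * w k <= rho * (M * t ^+ k) by rewrite ler_pM2l.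
have le2 : K * s ^+ k.+1 <= K * t ^+ k.+1 by rewrite ler_wpM2l.
apply: (le_trans (lerD le1 le2)).
have MK : K * t <= M * (t - rho).
  rewrite -ler_pdivrMr // /M; have := normr_ge0 (w 0%N); lra.
have -> : rho * (M * t ^+ k) + K * t ^+ k.+1 = (rho * M + K * t) * t ^+ k.
  by rewrite exprS; ring.
have -> : M * t ^+ k.+1 = (M * t) * t ^+ k by rewrite exprS; ring.
by rewrite ler_pM2r ?exprn_gt0 //; lra.
Qed.

(** * Lyapunov analysis for an abstract self-adjoint operator with a spectral gap *)

Section Lyapunov.
Variables (R : realFieldType) (V : lmodType R).
Variables (ip : V -> V -> R) (L : V -> V) (T : R).
Hypothesis ipC : forall x y, ip x y = ip y x.
Hypothesis ipDl : forall x y z, ip (x + y) z = ip x z + ip y z.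
Hypothesis ipZl : forall c x z, ip (c *: x) z = c * ip x z.
Hypothesis ip_ge0 : forall x, 0 <= ip x x.
Hypothesis LD : forall x y, L (x + y) = L x + L y.
Hypothesis LZ : forall c x, L (c *: x) = c *: L x.
Hypothesis Lsym : forall x y, ip x (L y) = ip (L x) y.
Hypothesis L_ge0 : forall x, 0 <= ip x (L x).
Hypothesis L_le2 : forall x, ip x (L x) <= 2 * ip x x.
Hypothesis T_ge0 : 0 <= T.
Hypothesis L_gap : forall x, ip x (L x) <= T * ip (L x) (L x).

Let ipDr x y z : ip z (x + y) = ip z x + ip z y.
Proof. by rewrite ipC ipDl !(ipC _ z). Qed.

Let ipZr c x z : ip z (c *: x) = c * ip z x.
Proof. by rewrite ipC ipZl ipC. Qed.

Let ipE := (LD, LZ, ipDl, ipDr, ipZl, ipZr).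

Lemma ip_young x y : `|ip x y| <= (ip x x + ip y y) / 2.
Proof.
have := ip_ge0 (x + y); have := ip_ge0 (x + (-1) *: y).
rewrite !ipE (ipC y x) => h1 h2; rewrite ler_norml; apply/andP; split; lra.
Qed.

(* Positivity of [L] at [x - L x / 2], together with [L <= 2] at [L x]. *)
Lemma normL_le x : ip (L x) (L x) <= 2 * ip x (L x).
Proof.
have := L_ge0 (x + (- 2^-1) *: L x); have := L_le2 (L x).
rewrite !ipE (Lsym x (L x)); lra.
Qed.

Variables (h a b : R).
Hypotheses (h0 : 0 < h) (a0 : 0 < a) (b0 : 0 < b).
Hypotheses (hb2 : h * b < 2) (hab : h * a < b).

Variable kap : R.
Hypothesis kapE : kap = 1 - h * b / 2.

Let kap0 : 0 < kap.
Proof. by rewrite kapE subr_gt0 ltr_pdivrMr // mul1r. Qed.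

Definition lyap (e : R) (x v : V) : R := a * ip x (L x) + kap * ip v v +
  e * (ip x (L v) + b / (2 * kap) * ip x (L x)).

(** Positivity of [L] at [x + c^-1 *: v] with [c = b / kap], followed by [L <= 2] at [v], bounds the
    bracket weighted by [e] below by [- (kap / b) |v|^2]. With [e <= b / 2] this costs at most half
    of [kap |v|^2]. *)
Lemma lyap_lower (e : R) x v : 0 <= e -> e <= b / 2 ->
  a * ip x (L x) + kap / 2 * ip v v <= lyap e x v.
Proof.
move=> e0 eb; pose c : R := b / kap.
have c0 : 0 < c by rewrite /c; positivity.
have q : 0 <= c * ip x (L x) + 2 * ip x (L v) + c^-1 * ip v (L v).
  have := mulr_ge0 (ltW c0) (L_ge0 (x + c^-1 *: v)).
  rewrite !ipE (Lsym v x) (ipC (L v) x); congr (_ <= _).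
  by field; rewrite gt_eqF.
have cross : - (c^-1 * ip v v) <= ip x (L v) + b / (2 * kap) * ip x (L x).
  have -> : b / (2 * kap) = c / 2 by rewrite /c; field; rewrite gt_eqF.
  have ci : 0 <= c^-1 by positivity.
  have := ler_wpM2l ci (L_le2 v).  lra.
have := ler_wpM2l e0 cross.
have := ler_wpM2r (mulr_ge0 (ltW (divr_gt0 kap0 b0)) (ip_ge0 v)) eb.
have -> : b / 2 * (kap / b * ip v v) = kap / 2 * ip v v by field; rewrite gt_eqF.
rewrite /lyap /c invf_div; lra.
Qed.

(** [lyap e] is a nonnegative quadratic form, and the right side minus the left is [t^-1] times its
    value at [(t x - y, t v - w)]. *)
Lemma lyap_young (e t : R) x v y w : 0 <= e -> e <= b / 2 -> 0 < t ->
  lyap e (x + y) (v + w) <= (1 + t) * lyap e x v + (1 + t^-1) * lyap e y w.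
Proof.
move=> e0 eb t0.
have : 0 <= lyap e (t *: x + (-1) *: y) (t *: v + (-1) *: w).
  apply: le_trans (lyap_lower _ _ _ e0 eb).
  by positivity.
have ti : 0 < t^-1 by rewrite invr_gt0.
move/(mulr_ge0 (ltW ti)); rewrite -subr_ge0 => p; rewrite -subr_ge0.
move: p; congr (_ <= _); rewrite /lyap !ipE; field.
by rewrite !gt_eqF.
Qed.

(** Here [m] is the mean of the old and new rates. The increment is first computed exactly as [E],
    after every pairing with [v] has been traded for pairings with [m] and [L x]. *)
Lemma lyap_step (e : R) x v m : 0 <= e ->
  kap *: v = m + (h * a / 2) *: L x ->
  lyap e (x + h *: m) (2 *: m + (-1) *: v) <= lyap e x v
    - (2 * h * (b - a * h) - e * (2 * h + h ^+ 3 * a / (2 * kap))) * ip m m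
    - e * (h * a / (2 * kap)) * ip (L x) (L x).
Proof.
move=> e0 vE.
have ipv z : ip z v = (ip z m + h * a / 2 * ip z (L x)) / kap.
  by rewrite -ipZr -ipDr -vE ipZr mulrAC mulfV ?gt_eqF // mul1r.
have kapN0 : kap != 0 by rewrite gt_eqF.
have mLx : ip m (L x) = ip x (L m) by rewrite Lsym ipC.
have mv : ip m v = (ip m m + h * a / 2 * ip x (L m)) / kap by rewrite ipv mLx.
have xLv : ip x (L v) = (ip x (L m) + h * a / 2 * ip (L x) (L x)) / kap.
  by rewrite Lsym ipv -Lsym.
have mLv : ip m (L v) = (ip m (L m) + h * a / 2 * ip (L m) (L x)) / kap.
  by rewrite Lsym ipv -Lsym.
have E : lyap e (x + h *: m) (2 *: m + (-1) *: v) = lyap e x v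
   + (a * h ^+ 2 * ip m (L m) - 2 * h * b * ip m m)
   + e * (h * ip m (L m)
          - h * a / kap * (ip (L x) (L x) + h / 2 * ip (L m) (L x))).
  rewrite /lyap !ipE (ipC v m) mLx mv xLv mLv.
  (* [b] and [kap] are dependent, so one is eliminated before [field] can see the cancellation of
     the [ip x (L m)] terms. *)
  have -> : b = 2 * (1 - kap) / h by rewrite kapE; field; rewrite gt_eqF.
  by field; rewrite kapN0 gt_eqF.
rewrite E.
have yg := ip_young ((h / 2) *: L m) (L x).
have mm := normL_le m; have m2 := L_le2 m.
(* Young's inequality spends only half of the gain in [|L x|^2]; the rest goes to [|m|^2] through
   [|L m|^2 <= 4 |m|^2]. *)
have cross : - (ip (L x) (L x) / 2 + h ^+ 2 / 2 * ip m m)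
    <= h / 2 * ip (L m) (L x).
  move: yg; rewrite !ipE ler_norml => /andP[yg _].
  have : h ^+ 2 / 8 * ip (L m) (L m) <= h ^+ 2 / 8 * (4 * ip m m).
    by rewrite ler_wpM2l ?divr_ge0 ?sqr_ge0 //; lra.
  by rewrite expr2; lra.
have k1 : 0 <= h * a / kap by positivity.
have c1 := ler_wpM2l k1 cross.
have c2 : a * h ^+ 2 * ip m (L m) <= a * h ^+ 2 * (2 * ip m m).
  apply: ler_wpM2l => //; positivity.
have c3 : h * ip m (L m) <= h * (2 * ip m m) by rewrite ler_pM2l.
have c4 : h * ip m (L m) - h * a / kap * (ip (L x) (L x) + h / 2 * ip (L m) (L x))
  <= (2 * h + h ^+ 3 * a / (2 * kap)) * ip m m
     - h * a / (2 * kap) * ip (L x) (L x).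
  have -> : h ^+ 3 * a / (2 * kap) = h * a / kap * (h ^+ 2 / 2).
    by field.
  have -> : h * a / (2 * kap) = h * a / kap / 2 by field.
  lra.
have := ler_wpM2l e0 c4; lra.
Qed.

(** The dissipated quantity controls the whole function: [vE] bounds [|v|^2], and the spectral gap
    [L_gap] bounds [<x, L x>] by [T |L x|^2]. *)
Lemma lyap_upper (e : R) : 0 <= e -> exists C, 0 <= C /\ forall x v m,
  kap *: v = m + (h * a / 2) *: L x ->
  lyap e x v <= C * (ip m m + ip (L x) (L x)).
Proof.
move=> e0; pose K : R := (2 + (h * a) ^+ 2 / 2) / kap ^+ 2.
have K0 : 0 <= K by rewrite /K; positivity.
have B0 : 0 <= b / (2 * kap) by positivity.
exists (a * T + kap * K + e * (2^-1 + K / 2 + b / (2 * kap) * T)); split.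
  by positivity.
move=> x v m vE; set S := ip m m + ip (L x) (L x).
have xS : ip (L x) (L x) <= S by rewrite /S; have := ip_ge0 m; lra.
have vS : ip v v <= K * S.
  rewrite /K mulrAC ler_pdivlMr ?exprn_gt0 // -[_ * kap ^+ 2]mulrC.
  have -> : kap ^+ 2 * ip v v = ip (kap *: v) (kap *: v) by rewrite !ipE; ring.
  have := ip_ge0 (m + (- (h * a / 2)) *: L x); rewrite vE !ipE (ipC (L x) m) /S.
  have := ip_ge0 m; have := mulr_ge0 (sqr_ge0 (h * a)) (ip_ge0 m).
  have := ip_ge0 (L x); rewrite !expr2; lra.
have qS : ip x (L x) <= T * S.
  by apply: (le_trans (L_gap x)); rewrite ler_wpM2l.
have xvS : ip x (L v) <= S / 2 + K / 2 * S.
  have := ip_young (L x) v; rewrite -(Lsym x v) ler_norml => /andP[_].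
  lra.
have := ler_wpM2l (ltW a0) qS; have := ler_wpM2l (ltW kap0) vS.
have := ler_wpM2l B0 qS => q1.
have : ip x (L v) + b / (2 * kap) * ip x (L x) <=
   S / 2 + K / 2 * S + b / (2 * kap) * (T * S) by lra.
move/(ler_wpM2l e0); rewrite /lyap; lra.
Qed.

Lemma lyap_contract : exists e rho,
  [/\ 0 <= e, e <= b / 2, 0 < rho, rho < 1 & forall x v u,
    u = (- a) *: L x + (- b) *: v ->
    lyap e (x + h *: v + (h ^+ 2 / 2) *: u) (v + h *: u) <= rho * lyap e x v].
Proof.
pose C1 : R := 2 * h + h ^+ 3 * a / (2 * kap); pose g : R := h * (b - a * h).
have g0 : 0 < g by rewrite mulr_gt0 // subr_gt0 mulrC.
have C10 : 0 < C1.
  by rewrite addr_gt0 ?mulr_gt0 // ?invr_gt0 ?exprn_gt0 ?mulr_gt0.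
(* The first bound on [e] keeps [lyap e] nonnegative; the second leaves at least [g] of the
   dissipation [2 * g] of [|m|^2]. *)
pose e : R := Num.min (b / 2) (g / C1).
have e0 : 0 < e by rewrite lt_min !divr_gt0.
have eb : e <= b / 2 by rewrite ge_min lexx.
have eg : e * C1 <= g by rewrite -ler_pdivlMr // ge_min lexx orbT.
have [C [C0 WC]] := lyap_upper _ (ltW e0).
pose eta : R := Num.min g (e * (h * a / (2 * kap))).
have eta0 : 0 < eta.
  by rewrite lt_min g0 !mulr_gt0 // invr_gt0 mulr_gt0.
(* Enlarging [C] by [2 * eta] keeps the contraction factor strictly between 0 and 1 even when [C] is
   0. *)
have C20 : 0 < C + 2 * eta by lra.
have etaC : eta / (C + 2 * eta) < 1 by rewrite ltr_pdivrMr //; lra.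
have etaC0 : 0 < eta / (C + 2 * eta) by positivity.
exists e, (1 - eta / (C + 2 * eta)); split; rewrite ?(ltW e0) //; try lra.
move=> x v u uE; pose m := v + (h / 2) *: u.
have vE : kap *: v = m + (h * a / 2) *: L x.
  have -> : kap *: v = v + (h / 2 * - b) *: v.
    by rewrite -[in RHS](scale1r v) scalerA -scalerDl kapE; congr (_ *: _); ring.
  rewrite /m uE !scalerDr !scalerA -!addrA; congr (v + _).
  rewrite addrCA -scalerDl (_ : h / 2 * - a + h * a / 2 = 0) ?scale0r ?addr0 //.
  by ring.
have -> : x + h *: v + (h ^+ 2 / 2) *: u = x + h *: m.
  rewrite /m scalerDr scalerA addrA; congr (_ + _ *: _).
  by field.
have -> : v + h *: u = 2 *: m + (-1) *: v.
  rewrite /m scalerDr scalerA addrAC -scalerDl mulrCA mulfV ?mulr1 ?pnatr_eq0 //.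
  by rewrite (_ : 2 + -1 = 1) ?scale1r //; lra.
apply: (le_trans (lyap_step e x v m (ltW e0) vE)).
rewrite -/C1; have := WC _ _ _ vE; set W := lyap e x v; set S := _ + _ => WS.
have mm0 := ip_ge0 m; have xx0 := ip_ge0 (L x).
have S0 : 0 <= S by rewrite addr_ge0.
have d1 : eta * ip m m <= (2 * h * (b - a * h) - e * C1) * ip m m.
  apply: ler_wpM2r => //; have : eta <= g by rewrite ge_min lexx.
  by move: eg; rewrite /g; lra.
have d2 : eta * ip (L x) (L x) <= e * (h * a / (2 * kap)) * ip (L x) (L x).
  by apply: ler_wpM2r => //; rewrite ge_min lexx orbT.
have d3 : eta / (C + 2 * eta) * W <= eta * S.
  rewrite mulrAC ler_pdivrMr // -mulrA ler_pM2l // mulrC.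
  by apply: (le_trans WS); have := mulr_ge0 (ltW eta0) S0; lra.
by move: d1 d2 d3; rewrite /S; lra.
Qed.

(** A correction moves [x] and [v] along one common vector, so its energy is bounded by the squared
    norm. The coefficient [c] may be negative, hence its absolute value. *)
Lemma lyap_input (e c1 c2 : R) : 0 <= e -> exists K, 0 <= K /\ forall x,
  lyap e (c1 *: x) (c2 *: x) <= K * ip x x.
Proof.
move=> e0.
pose c : R := a * c1 ^+ 2 + e * (c1 * c2 + b / (2 * kap) * c1 ^+ 2).
have k0 : 0 <= kap * c2 ^+ 2 by positivity.
exists (2 * `|c| + kap * c2 ^+ 2); split.
  by positivity.
move=> x; have -> : lyap e (c1 *: x) (c2 *: x) =
    c * ip x (L x) + kap * c2 ^+ 2 * ip x x.
  by rewrite /lyap !ipE /c; ring.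
rewrite [leRHS]mulrDl lerD2r (mulrC 2) -mulrA.
apply: (@le_trans _ _ (`|c| * ip x (L x))); first by rewrite ler_wpM2r ?ler_norm.
by rewrite ler_wpM2l.
Qed.

Lemma exponential_decay (x v u al : nat -> V) (D s : R) :
  0 < s -> s < 1 -> 0 <= D ->
  (forall k, ip (al k.+1) (al k.+1) <= D * s ^+ k.+1) ->
  (forall k, u k.+1 = (- a) *: L (x k) + (- b) *: v k + a *: al k.+1) ->
  (forall k, x k.+1 = x k - al k.+1 + h *: v k + (h ^+ 2 / 2) *: u k.+1) ->
  (forall k, v k.+1 = v k + h *: u k.+1) ->
  exists t M, [/\ s <= t, t < 1, 0 < M & forall k,
    ip (x k) (L (x k)) <= M * t ^+ k /\ ip (v k) (v k) <= M * t ^+ k].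
Proof.
move=> s0 s1 D0 alD uE xE vE.
have [e [rho [e0 eb rho0 rho1 contr]]] := lyap_contract.
(* A correction shifts [x] directly by [- al] and again through its term [a *: al] in the input,
   which alone reaches [v]. *)
pose c1 : R := h ^+ 2 / 2 * a - 1; pose c2 : R := h * a.
have [K [K0 inp]] := lyap_input e c1 c2 e0.
(* Chosen so that [(1 + y) * rho = (1 + rho) / 2], which is still below 1. *)
pose y : R := (1 - rho) / (2 * rho).
have y0 : 0 < y by rewrite divr_gt0 ?mulr_gt0 ?subr_gt0.
have yi : 0 <= 1 + y^-1 by rewrite addr_ge0 // invr_ge0 ltW.
have rec k : lyap e (x k.+1) (v k.+1) <=
   (1 + rho) / 2 * lyap e (x k) (v k) + (1 + y^-1) * (K * D) * s ^+ k.+1.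
  pose u' := (- a) *: L (x k) + (- b) *: v k.
  have -> : x k.+1 = (x k + h *: v k + (h ^+ 2 / 2) *: u') + c1 *: al k.+1.
    rewrite xE uE -/u' scalerDr scalerA /c1 scalerBl scale1r.
    by rewrite -!addrA; congr (_ + _); rewrite addrC -!addrA.
  have -> : v k.+1 = (v k + h *: u') + c2 *: al k.+1.
    by rewrite vE uE -/u' scalerDr scalerA addrA.
  apply: (le_trans (lyap_young e y _ _ _ _ e0 eb y0)); apply: lerD.
    have -> : (1 + rho) / 2 = (1 + y) * rho by rewrite /y; field; rewrite gt_eqF.
    by rewrite -[leRHS]mulrA ler_pM2l ?contr //; lra.
  rewrite -[leRHS]mulrA ler_wpM2l //; apply: (le_trans (inp _)).
  by rewrite -[leRHS]mulrA ler_wpM2l.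
have r0 : 0 < (1 + rho) / 2 by lra.
have r1 : (1 + rho) / 2 < 1 by lra.
have KD : 0 <= (1 + y^-1) * (K * D) by rewrite !mulr_ge0.
have [t [M [st t1 M0 WM]]] := geometric_recurrence _ _ _ _ _ r0 r1 s0 s1 KD rec.
have k20 : 0 < kap / 2 by positivity.
exists t, (M / a + M / (kap / 2)); split => //; first by rewrite addr_gt0 ?divr_gt0.
move=> k; have := le_trans (lyap_lower e (x k) (v k) e0 eb) (WM k).
have tk : 0 <= t ^+ k by rewrite exprn_ge0 // ltW // (lt_le_trans s0).
have p1 := mulr_ge0 (ltW a0) (L_ge0 (x k)).
have p2 := mulr_ge0 (ltW k20) (ip_ge0 (v k)) => le_M.
have Mk : 0 <= M * t ^+ k by positivity.
rewrite !mulrDl; split.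
  apply: (@le_trans _ _ (M / a * t ^+ k)).
    by rewrite mulrAC ler_pdivlMr // mulrC; lra.
  by rewrite lerDl; positivity.
apply: (@le_trans _ _ (M / (kap / 2) * t ^+ k)).
  by rewrite [leRHS]mulrAC ler_pdivlMr // mulrC; lra.
by rewrite lerDr; positivity.
Qed.

End Lyapunov.

(** * The normalized graph Laplacian and its spectral gap *)

Section GraphLaplacian.
Variables (R : realFieldType) (N : nat) (adj : rel 'I_N).
Hypothesis adj_sym : symmetric adj.
Hypothesis adj_connected : forall i j, connect adj i j.
Hypothesis adj_nonempty : forall i, exists j, adj i j.

Definition degree (i : 'I_N) : R := (#|[pred j | adj i j]|)%:R.

Definition wdot (x y : 'rV[R]_N) : R := \sum_i degree i * x 0 i * y 0 i.

Definition laplacian (x : 'rV[R]_N) : 'rV[R]_N :=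
  \row_i (x 0 i - (\sum_(j | adj i j) x 0 j) / degree i).

Lemma degree_ge1 i : 1 <= degree i.
Proof.
rewrite /degree ler1n; have [j ij] := adj_nonempty i.
by apply/card_gt0P; exists j; rewrite inE.
Qed.

Let degree_gt0 i : 0 < degree i.
Proof. exact: lt_le_trans (degree_ge1 i). Qed.

Lemma wdotC x y : wdot x y = wdot y x.
Proof. by apply: eq_bigr => i _; rewrite mulrAC. Qed.

Lemma wdotDl (x y z : 'rV[R]_N) : wdot (x + y) z = wdot x z + wdot y z.
Proof. by rewrite -big_split; apply: eq_bigr => i _; rewrite mxE /=; ring. Qed.

Lemma wdotZl c (x z : 'rV[R]_N) : wdot (c *: x) z = c * wdot x z.
Proof. by rewrite mulr_sumr; apply: eq_bigr => i _; rewrite mxE; ring. Qed.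

Lemma wdot_term_ge0 (x : 'rV[R]_N) i : 0 <= degree i * x 0 i * x 0 i.
Proof. by rewrite -mulrA -expr2 mulr_ge0 ?sqr_ge0 // ltW. Qed.

Lemma wdot_ge0 x : 0 <= wdot x x.
Proof. by apply: sumr_ge0 => i _; apply: wdot_term_ge0. Qed.

Lemma coord_sqr_le_wdot (x : 'rV[R]_N) i : x 0 i ^+ 2 <= wdot x x.
Proof.
rewrite /wdot (bigD1 i) //=; apply: (@le_trans _ _ (degree i * x 0 i * x 0 i)).
  by rewrite -mulrA -expr2 ler_peMl ?sqr_ge0 ?degree_ge1.
by rewrite lerDl sumr_ge0 // => j _; apply: wdot_term_ge0.
Qed.

Lemma laplacianD (x y : 'rV[R]_N) : laplacian (x + y) = laplacian x + laplacian y.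
Proof.
apply/rowP => i; rewrite !mxE.
under eq_bigr do rewrite mxE.
by rewrite big_split /=; ring.
Qed.

Lemma laplacianZ c (x : 'rV[R]_N) : laplacian (c *: x) = c *: laplacian x.
Proof.
apply/rowP => i; rewrite !mxE.
under eq_bigr do rewrite mxE.
by rewrite -mulr_sumr; ring.
Qed.

Lemma degreeE (c : R) i : degree i * c = \sum_(j | adj i j) c.
Proof. by rewrite sumr_const /degree mulr_natl. Qed.

Lemma edge_sum_swap (F : 'I_N -> 'I_N -> R) :
  \sum_i \sum_(j | adj i j) F i j = \sum_i \sum_(j | adj i j) F j i.
Proof.
rewrite (exchange_big_dep xpredT) //=.
by apply: eq_bigr => i _; apply: eq_bigl => j; rewrite adj_sym.
Qed.

(** This is the Dirichlet form: averaging the sum over ordered edges with its reversal turns the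
    factor [x 0 i] into [x 0 i - x 0 j]. *)
Lemma wdot_laplacian x y : wdot x (laplacian y) =
  2^-1 * \sum_i \sum_(j | adj i j) (x 0 i - x 0 j) * (y 0 i - y 0 j).
Proof.
have -> : wdot x (laplacian y) =
    \sum_i \sum_(j | adj i j) x 0 i * (y 0 i - y 0 j).
  apply: eq_bigr => i _; rewrite mxE -mulr_sumr sumrB -degreeE.
  by have /lt0r_neq0 n0 := degree_gt0 i; field.
set S := \sum_i _; have S2 : S = 2^-1 * (S + S) by lra.
rewrite S2; congr (_ * _); rewrite {2}/S edge_sum_swap -big_split.
apply: eq_bigr => i _; rewrite -big_split; apply: eq_bigr => j _ /=; ring.
Qed.

Lemma laplacian_sym x y : wdot x (laplacian y) = wdot (laplacian x) y.
Proof.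
rewrite (wdotC _ y) !wdot_laplacian; congr (_ * _).
by apply: eq_bigr => i _; apply: eq_bigr => j _; rewrite mulrC.
Qed.

Lemma laplacian_ge0 x : 0 <= wdot x (laplacian x).
Proof.
rewrite wdot_laplacian mulr_ge0 ?invr_ge0 //.
by apply: sumr_ge0 => i _; apply: sumr_ge0 => j _; rewrite -expr2 sqr_ge0.
Qed.

(** Edge by edge this is [(p - q)^2 <= 2 p^2 + 2 q^2], since [wdot x x] is the edge sum of the
    squares at either endpoint. *)
Lemma laplacian_le2 x : wdot x (laplacian x) <= 2 * wdot x x.
Proof.
have E1 : wdot x x = \sum_i \sum_(j | adj i j) x 0 i ^+ 2.
  by apply: eq_bigr => i _; rewrite -degreeE expr2 mulrA.
have E2 : wdot x x = \sum_i \sum_(j | adj i j) x 0 j ^+ 2.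
  by rewrite E1 edge_sum_swap.
have -> : 2 * wdot x x = 2^-1 * (2 * wdot x x + 2 * wdot x x) by lra.
rewrite {1}E1 E2 wdot_laplacian ler_pM2l ?invr_gt0 // -mulrDr -big_split /=.
rewrite mulr_sumr; apply: ler_sum => i _.
rewrite -big_split /= mulr_sumr; apply: ler_sum => j _.
by have := sqr_ge0 (x 0 i + x 0 j); rewrite !expr2; lra.
Qed.

Lemma edge_sqr_le (x : 'rV[R]_N) i j : adj i j ->
  (x 0 i - x 0 j) ^+ 2 <= 2 * wdot x (laplacian x).
Proof.
move=> ij; rewrite wdot_laplacian mulrA mulfV ?pnatr_eq0 // mul1r.
have sq k l : 0 <= (x 0 k - x 0 l) * (x 0 k - x 0 l) by rewrite -expr2 sqr_ge0.
rewrite (bigD1 i) //= (bigD1 j ij) /= -expr2 -addrA lerDl.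
by rewrite addr_ge0 ?sumr_ge0 // => k _; rewrite sumr_ge0.
Qed.

Definition poincare_const : R := 2 ^+ N.+1.

Lemma poincare (x : 'rV[R]_N) i j :
  (x 0 i - x 0 j) ^+ 2 <= poincare_const * wdot x (laplacian x).
Proof.
have q0 := laplacian_ge0 x; set q := wdot _ _ in q0 *.
(* Each edge of the path costs a factor 2, by [(a + b)^2 <= 2 a^2 + 2 b^2]. *)
have along_path p : forall k, path adj k p ->
    (x 0 k - x 0 (last k p)) ^+ 2 <= 2 ^+ (size p).+1 * (2 * q) - 2 * (2 * q).
  (* The subtracted [2 * (2 * q)] makes the bound 0 on the empty path and is reproduced exactly by
     the inductive step. *)
  elim: p => [|l p IHp] k /=; first by rewrite subrr expr0n expr1 subrr.
  case/andP => /(edge_sqr_le x) kl /IHp; rewrite -/q in kl *.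
  rewrite (exprS 2 (size p).+1); set c := 2 ^+ _; set z := last _ _.
  have := sqr_ge0 ((x 0 k - x 0 l) - (x 0 l - x 0 z)).
  by move: kl; rewrite !expr2; lra.
have /connectP[p0 p0P ->] := adj_connected i j.
(* A duplicate-free path has fewer than [N] edges, which makes the constant uniform in [i] and
   [j]. *)
case/shortenP: p0P => p pP pU _; apply: (le_trans (along_path p i pP)).
have sz : (size p < N)%N.
  by rewrite -[N in (_ < N)%N]card_ord -/(size (i :: p)) -(card_uniqP pU) max_card.
have : 2 ^+ (size p).+1 <= 2 ^+ N :> R by rewrite ler_weXn2l // ler1n.
by move/(ler_wpM2r q0); rewrite /poincare_const (exprS 2 N); lra.
Qed.

Definition spectral_const : R := (\sum_i degree i) * poincare_const.

Lemma spectral_const_ge0 : 0 <= spectral_const.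
Proof. by rewrite mulr_ge0 ?exprn_ge0 // sumr_ge0 // => i _; rewrite ltW. Qed.

(* [laplacian x] is orthogonal to the constants, so [x] may be recentred at one
   of its coordinates before Young's inequality is applied. *)
Lemma laplacian_gap x : wdot x (laplacian x) <=
  spectral_const * wdot (laplacian x) (laplacian x).
Proof.
have [i0|N0] := pickP (fun _ : 'I_N => true); last first.
  by rewrite /wdot !big_pred0 // mulr0.
move=> _; set g := laplacian x; set T := spectral_const.
have T0 : 0 < T.
  rewrite mulr_gt0 ?exprn_gt0 // (bigD1 i0) //=.
  by rewrite ltr_wpDr // sumr_ge0 // => i _; rewrite ltW.
have one : wdot (const_mx 1) g = 0.
  rewrite wdot_laplacian big1 ?mulr0 // => i _; rewrite big1 // => j _.
  by rewrite !mxE subrr mul0r.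
have E : wdot x g = \sum_i degree i * ((x 0 i - x 0 i0) * g 0 i).
  transitivity (wdot x g - x 0 i0 * wdot (const_mx 1) g).
    by rewrite one mulr0 subr0.
  rewrite /wdot mulr_sumr -sumrB.
  by apply: eq_bigr => i _; rewrite [const_mx 1 0 i]mxE; ring.
(* Young's inequality with weight [T], chosen so that the Poincare terms add up to [wdot x g / 2],
   which the left side absorbs. *)
have : wdot x g <= \sum_i (degree i * (poincare_const * wdot x g / (2 * T))
    + T / 2 * (degree i * g 0 i * g 0 i)).
  rewrite {1}E; apply: ler_sum => i _.
  have -> : T / 2 * (degree i * g 0 i * g 0 i) = degree i * (T / 2 * g 0 i ^+ 2).
    by ring.
  rewrite -mulrDr ler_pM2l //.
  have := poincare x i i0; rewrite -/g => pc.
  have k0 : 0 <= (2 * T)^-1 by rewrite invr_ge0 mulr_ge0 // ltW.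
  have := ler_wpM2r k0 pc.
  have := mulr_ge0 k0 (sqr_ge0 ((x 0 i - x 0 i0) - T * g 0 i)).
  have -> : (2 * T)^-1 * (x 0 i - x 0 i0 - T * g 0 i) ^+ 2 =
    (x 0 i - x 0 i0) ^+ 2 / (2 * T) - (x 0 i - x 0 i0) * g 0 i
      + T / 2 * g 0 i ^+ 2 by field; rewrite gt_eqF.
  by lra.
rewrite big_split /= -mulr_suml -mulr_sumr -/(wdot g g).
have -> : (\sum_i degree i) * (poincare_const * wdot x g / (2 * T)) = wdot x g / 2.
  transitivity (T * wdot x g / (2 * T)); first by rewrite /T /spectral_const; ring.
  by field; rewrite gt_eqF.
lra.
Qed.

End GraphLaplacian.

(** * Closed form and gain bounds of the one-step controller *)

Section Scheme.
Variables (R : realType) (N : nat) (adj : rel 'I_N) (w1 w2 w3 h : R).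
Hypotheses (w1_gt0 : 0 < w1) (w2_gt0 : 0 < w2) (w3_gt0 : 0 < w3) (h_gt0 : 0 < h).
Hypothesis adj_nonempty : forall i, exists j, adj i j.

Definition mpc_den : R := w3 + w2 * h ^+ 2 + w1 * h ^+ 4 / 4.
Definition mpc_a : R := w1 * h ^+ 2 / (2 * mpc_den).
Definition mpc_b : R := (w2 * h + w1 * h ^+ 3 / 2) / mpc_den.

Lemma mpc_den_gt0 : 0 < mpc_den.
Proof. by rewrite /mpc_den; positivity. Qed.

(** Supplies the gain conditions of the Lyapunov analysis for every [h > 0]. After clearing
    [mpc_den], the last two have slack [2 * w3 + w2 * h ^+ 2] and [w2 * h]. *)
Lemma mpc_gain_bounds :
  [/\ 0 < mpc_a, 0 < mpc_b, h * mpc_b < 2 & h * mpc_a < mpc_b].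
Proof.
have D0 := mpc_den_gt0; have w2h : 0 < w2 * h by positivity.
split; rewrite /mpc_a /mpc_b; [by positivity|by positivity| |].
  rewrite mulrA ltr_pdivrMr // /mpc_den.
  have : 0 < w2 * h ^+ 2 by positivity.
  by move: w3_gt0; rewrite !exprS expr0; lra.
rewrite ltr_pdivlMr // mulrA mulrAC ltr_pdivrMr ?mulr_gt0 //.
rewrite -subr_gt0.
have -> : (w2 * h + w1 * h ^+ 3 / 2) * (2 * mpc_den) - h * (w1 * h ^+ 2) * mpc_den
   = 2 * (w2 * h) * mpc_den by field.
by positivity.
Qed.

(** As a polynomial in the input, the cost has leading coefficient [mpc_den], and its linear
    coefficient [B] sees the neighbors only through their mean [S / n]. *)
Lemma mpc_minimizer i (del0 deld0 u : R) (prev : 'I_N -> R) :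
  (forall v, mpc_cost adj w1 w2 w3 h i del0 deld0 prev u
     <= mpc_cost adj w1 w2 w3 h i del0 deld0 prev v) ->
  u = - mpc_a * (del0 - (\sum_(j | adj i j) prev j) / degree R N adj i)
      - mpc_b * deld0.
Proof.
move=> umin; set n := degree R N adj i.
have n0 : 0 < n by apply: lt_le_trans (degree_ge1 _ _ _ adj_nonempty i).
have D0 := mpc_den_gt0; set S := \sum_(j | _) _.
pose c := del0 + h * deld0.
pose B := w1 * h ^+ 2 * (c - S / n) + 2 * w2 * h * deld0.
pose C := w1 / n * \sum_(j | adj i j) (c - prev j) ^+ 2 + w2 * deld0 ^+ 2.
have costE v : mpc_cost adj w1 w2 w3 h i del0 deld0 prev v =
    mpc_den * v ^+ 2 + B * v + C.
  have -> : mpc_cost adj w1 w2 w3 h i del0 deld0 prev v =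
     w1 / n * (\sum_(j | adj i j) (c - prev j) ^+ 2
       + (n * (h ^+ 2 / 2 * v) ^+ 2 + h ^+ 2 * v * (n * c - S)))
     + w2 * (deld0 + h * v) ^+ 2 + w3 * v ^+ 2.
    rewrite /mpc_cost -/(degree R N adj i) -/n; congr (_ / n * _ + _ + _).
    rewrite /S !degreeE -sumrB mulr_sumr -!big_split /=.
    by apply: eq_bigr => j _; rewrite /c; field.
  by rewrite /C /B /mpc_den; field; rewrite gt_eqF.
have uE : 2 * mpc_den * u = - B.
  apply: quadratic_minimizer => // y.
  by have := umin y; rewrite !costE; lra.
have -> : u = - B / (2 * mpc_den).
  by rewrite -uE mulrAC mulfV ?mul1r // gt_eqF // mulr_gt0.
by rewrite /B /c /mpc_a /mpc_b; field; rewrite !gt_eqF.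
Qed.

End Scheme.

(** * Exponential coordination of the scheme *)

Theorem theorem1 (R : realType) (N : nat) (adj : rel 'I_N) (w1 w2 w3 d nu : R) :
  (2 <= N)%N ->
  symmetric adj -> irreflexive adj ->
  (forall i j, connect adj i j) ->
  (forall i, exists j, adj i j) ->
  0 < w1 -> 0 < w2 -> 0 < w3 -> 0 < d -> 0 < nu ->
  exists h0 : R, 0 < h0 /\
  forall h : R, 0 < h -> h < h0 ->
  forall (alpha : nat -> 'I_N -> R)
         (del0 deld0 u del1 deld1 : nat -> 'I_N -> R),
  (forall k i, (1 <= k)%N -> `|alpha k i| <= d * expR (- nu * k%:R * h)) ->
  (forall k i, (1 <= k)%N -> del0 k i = del1 k.-1 i - alpha k i) ->
  (forall k i, (1 <= k)%N -> deld0 k i = deld1 k.-1 i) ->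
  (forall k i, (1 <= k)%N -> forall v : R,
      mpc_cost adj w1 w2 w3 h i (del0 k i) (deld0 k i) (del1 k.-1) (u k i)
      <= mpc_cost adj w1 w2 w3 h i (del0 k i) (deld0 k i) (del1 k.-1) v) ->
  (forall k i, (1 <= k)%N ->
      del1 k i = del0 k i + h * deld0 k i + h ^+ 2 / 2 * u k i) ->
  (forall k i, (1 <= k)%N -> deld1 k i = deld0 k i + h * u k i) ->
  exists r M Md : R, [/\ 0 < r, r < 1, 0 < M, 0 < Md &
    forall k i j, (1 <= k)%N ->
      `|del0 k i - del0 k j| <= M * r ^+ k /\ `|deld0 k i| <= Md * r ^+ k].
Proof.
move=> _ asym _ aconn anbr w10 w20 w30 d0 nu0; exists 1; split=> // h h0 _.
move=> alpha del0 deld0 u del1 deld1 alphaB del0E deld0E umin del1E deld1E.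
have [a0 b0 hb2 hab] := mpc_gain_bounds R w1 w2 w3 h w10 w20 w30 h0.
set a := mpc_a _ _ _ _ _ in a0 hab; set b := mpc_b _ _ _ _ _ in b0 hb2 hab.
pose s := expR (- nu * h); have s0 : 0 < s := expR_gt0 _.
have s1 : s < 1 by rewrite expR_lt1 mulNr oppr_lt0 mulr_gt0.
have alphaS k i : (1 <= k)%N -> `|alpha k i| <= d * s ^+ k.
  move=> k1; rewrite -expRM_natl; apply: le_trans (alphaB k i k1) _.
  by rewrite (_ : - nu * k%:R * h = k%:R * (- nu * h)) //; ring.
(* The state is taken at the end of an iteration, so index 0 holds the arbitrary initial data. *)
pose x k : 'rV[R]_N := \row_i del1 k i; pose v k : 'rV[R]_N := \row_i deld1 k i.
pose al k : 'rV[R]_N := \row_i alpha k i; pose U k : 'rV[R]_N := \row_i u k i.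
pose D := (\sum_i degree R N adj i) * d ^+ 2.
have D0 : 0 <= D by rewrite mulr_ge0 ?sqr_ge0 // sumr_ge0.
have ss0 : 0 < s ^+ 2 by rewrite exprn_gt0.
have ss1 : s ^+ 2 < 1 by rewrite exprn_ilt1 // ltW.
have [||||t [M [st t1 M0 tM]]] := exponential_decay R _ (wdot R N adj)
  (laplacian R N adj) (spectral_const R N adj) (wdotC _ _ _) (wdotDl _ _ _)
  (wdotZl _ _ _) (wdot_ge0 _ _ _) (laplacianD _ _ _) (laplacianZ _ _ _)
  (laplacian_sym _ _ _ asym anbr) (laplacian_ge0 _ _ _ asym anbr)
  (laplacian_le2 _ _ _ asym anbr) (spectral_const_ge0 _ _ _)
  (laplacian_gap _ _ _ asym aconn anbr) h a b h0 a0 b0 hb2 hab _ erefl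
  x v U al D (s ^+ 2) ss0 ss1 D0.
- move=> k; rewrite /wdot /D -mulrA mulr_suml; apply: ler_sum => i _.
  rewrite mxE -mulrA ler_wpM2l // -expr2 -exprM mulnC exprM -exprMn.
  rewrite -(real_normK (num_real (alpha k.+1 i))) lerXn2r ?nnegrE //; last exact: alphaS.
  by rewrite mulr_ge0 ?exprn_ge0 // ltW.
- move=> k; apply/rowP => i; rewrite !mxE.
  rewrite (mpc_minimizer R N adj w1 w2 w3 h _ _ _ _ anbr _ _ _ _ _ (umin k.+1 i _)) //.
  rewrite del0E // deld0E //= -/a -/b.
  by under [in RHS]eq_bigr do rewrite mxE; ring.
- by move=> k; apply/rowP => i; rewrite !mxE del1E // del0E // deld0E.
- by move=> k; apply/rowP => i; rewrite !mxE deld1E // deld0E.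
have t0 : 0 < t by apply: lt_le_trans st.
(* [t] governs squared quantities, hence the root; [s ^+ 2 <= t] gives [s <= r]. *)
pose r := Num.sqrt t; have r0 : 0 < r by rewrite sqrtr_gt0.
have rE : r ^+ 2 = t by rewrite sqr_sqrtr // ltW.
have r1 : r < 1 by rewrite -(@ltr_pXn2r _ 2) ?nnegrE ?expr1n ?rE // ltW.
have sr : s <= r by rewrite -(@ler_pXn2r _ 2) ?nnegrE ?rE // ltW.
have P0 : 0 < poincare_const R N by rewrite exprn_gt0.
(* Dividing by [r] pays for the index shift: [del0] and [deld0] at [k.+1] are read off the state at
   [k]. *)
have root z k y : 0 <= z -> y ^+ 2 <= z * t ^+ k ->
    `|y| <= Num.sqrt z / r * r ^+ k.+1.
  move=> z0 yz; rewrite exprS mulrA divfK ?gt_eqF //.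
  rewrite -(@ler_pXn2r _ 2) ?nnegrE ?mulr_ge0 ?sqrtr_ge0 ?exprn_ge0 ?(ltW r0) //.
  by rewrite (real_normK (num_real y)) exprMn sqr_sqrtr // -exprM mulnC exprM rE.
(* The summand [2 * d] covers the corrections of the two agents being compared. *)
exists r, (Num.sqrt (poincare_const R N * M) / r + 2 * d), (Num.sqrt M / r).
split; rewrite ?addr_gt0 ?divr_gt0 ?sqrtr_gt0 ?mulr_gt0 //.
move=> [//|k] i j _; have [qk vk] := tM k.
split; last first.
  rewrite deld0E //; apply: root; first exact: ltW.
  by have := coord_sqr_le_wdot R N adj anbr (v k) i; rewrite mxE => /le_trans; apply.
rewrite !del0E //= mulrDl.
have -> : del1 k i - alpha k.+1 i - (del1 k j - alpha k.+1 j) =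
  (del1 k i - del1 k j) + (alpha k.+1 j - alpha k.+1 i) by ring.
apply: (le_trans (ler_normD _ _)); apply: lerD.
  apply: root; first by rewrite mulr_ge0 // ltW.
  have := poincare R N adj asym aconn anbr (x k) i j; rewrite !mxE => /le_trans; apply.
  by rewrite -mulrA ler_pM2l.
apply: (le_trans (ler_normB _ _)).
have ar l : `|alpha k.+1 l| <= d * r ^+ k.+1.
  apply: (le_trans (alphaS _ _ _)) => //; rewrite ler_pM2l //.
  by rewrite lerXn2r ?nnegrE // ltW.
by have := ar i; have := ar j; lra.
Qed.
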